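(* Let $n\ge 1$ be an integer, let $\mathbb{F}_{2^{2n}}$ be the field with $2^{2n}$ elements, and let $G_{2^{2n},2^n+1}=\{x\in\mathbb{F}_{2^{2n}}: x^{2^n+1}=1\}$ be the unique subgroup of order $2^n+1$ of $\mathbb{F}_{2^{2n}}^\times$. For $a,b,c,d\in G_{2^{2n},2^n+1}$, we have $a+b+c+d=0$ if and only if, after renaming the four elements if necessary, $a=b$ and $c=d$. *)

(* Defs.v *)
From mathcomp Require Import all_boot all_order all_fingroup all_algebra.
From mathcomp Require Import all_solvable all_field.

Set Implicit Arguments.
Unset Strict Implicit.
Unset Printing Implicit Defensive.

Import GRing.Theory.
Local Open Scope ring_scope.

Definition rootsG (F : finFieldType) (m : nat) : {set F} :=
  [set x : F | x ^+ m == 1].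

Lemma rootsG_unique (F : finFieldType) (m : nat)
    (S := [set u : {unit F} | FinRing.uval u \in rootsG F m]) :
  (m %| #|F|.-1)%N ->
  [/\ group_set S, #|S| = m &
      forall H : {group {unit F}}, #|H| = m -> H = S :> {set {unit F}}].
Proof.
move=> dvd_m.
have cT : cyclic [set: {unit F}] := field_unit_group_cyclic [set: {unit F}]%G.
have m_gt0 : (0 < m)%N.
  have : (0 < #|F|.-1)%N by rewrite -subn1 subn_gt0 finNzRing_gt1.
  by move=> /dvdn_gt0; apply.
have [x Tx] := cyclicP cT.
have ox : #[x]%g = #|F|.-1 by rewrite orderE -Tx card_finField_unit.
pose K := <[x ^+ (#|F|.-1 %/ m)]>%G.
have oK : #|K| = m.
  rewrite -[LHS]/#[_]%g orderXdiv ox; last exact: dvdn_div.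
  by rewrite -{1}(divnK dvd_m) mulKn // divn_gt0 // dvdn_leq // -ox order_gt0.
have sKS : K \subset S.
  apply/subsetP=> u uK; rewrite !inE -FinRing.val_unitX -oK.
  by rewrite expg_cardG.
have leSm : (#|S| <= m)%N.
  rewrite cardE -(size_map (@FinRing.uval F)).
  apply: (max_unity_roots m_gt0).
    apply/allP=> _ /mapP[u uS ->]; rewrite mem_enum !inE in uS.
    by apply/unity_rootP/eqP.
  by rewrite map_inj_uniq ?enum_uniq //; apply: val_inj.
have -> : S = K by apply/eqP; rewrite eq_sym eqEcard sKS oK.
split=> [||H oH]; [exact: groupP | exact: oK |].
by apply/eqP; rewrite (eq_subG_cyclic cT (subsetT _) (subsetT _)) oK oH.
Qed.

(* Main.v *)
(** Write [q = 2 ^ n]. On the subgroup of order [q + 1] the additive map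
    [x |-> x ^+ q] is inversion, so [a + b + c + d = 0] forces the sum of the
    inverses, hence the third elementary symmetric function, to vanish as well.
    Then [(a + b) (a + c) (a + d) = a^2 e1 + e3 = 0], so in characteristic 2
    the element [a] equals one of the others, and the remaining two agree. *)
Require Import Defs.
From mathcomp Require Import all_boot all_order all_fingroup all_algebra.
From mathcomp Require Import all_solvable all_field.
From mathcomp Require Import ring.

Import GRing.Theory.
Local Open Scope ring_scope.

Lemma mem_rootsG_exp {F : finFieldType} {m : nat} {x : F} :
  x \in rootsG F (m + 1) -> x != 0 /\ x ^+ m = x^-1.
Proof.
rewrite inE addn1 exprS => /eqP xm1.
have x0 : x != 0 by apply: contra_eq_neq xm1 => ->; rewrite mul0r eq_sym
  oner_neq0.
by split=> //; apply: (mulfI x0); rewrite xm1 mulfV.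
Qed.

(** The factor [a * b * c * d] clears the denominators of the inverses and produces the third
    elementary symmetric function; the resulting identity holds in every characteristic. *)
Lemma prod_add_eq0 {F : fieldType} {a b c d : F} :
  a != 0 -> b != 0 -> c != 0 -> d != 0 ->
  a + b + c + d = 0 -> a^-1 + b^-1 + c^-1 + d^-1 = 0 ->
  (a + b) * (a + c) * (a + d) = 0.
Proof.
move=> a0 b0 c0 d0 e1 eV.
have -> : (a + b) * (a + c) * (a + d) =
    a ^+ 2 * (a + b + c + d) + a * b * c * d * (a^-1 + b^-1 + c^-1 + d^-1).
  by field; rewrite a0 b0 c0 d0.
by rewrite e1 eV !mulr0 addr0.
Qed.

Theorem theorem1 (n : nat) (hn : (1 <= n)%N)
    (F : finFieldType) (hF : #|F| = (2 ^ (2 * n))%N)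
    (a b c d : F)
    (ha : a \in rootsG F (2 ^ n + 1)) (hb : b \in rootsG F (2 ^ n + 1))
    (hc : c \in rootsG F (2 ^ n + 1)) (hd : d \in rootsG F (2 ^ n + 1)) :
  a + b + c + d = 0 <->
  exists a' b' c' d' : F,
    perm_eq [:: a; b; c; d] [:: a'; b'; c'; d'] /\ a' = b' /\ c' = d'.
Proof.
have ch2 : 2%N \in [pchar F] by apply: card_finPcharP hF _.
have addxx (x : F) : x + x = 0 by apply: addrr_pchar2.
have add0P (x y : F) : x + y = 0 -> x = y.
  by move/eqP; rewrite addr_eq0 oppr_pchar2 // => /eqP.
split=> [sum0 | [x [y [z [w [eq_s [xy zw]]]]]]]; last first.
  (* As a sum over a list, the left side is invariant under [perm_eq]; equal pairs then cancel. *)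
  have -> : a + b + c + d = \sum_(t <- [:: a; b; c; d]) t.
    by rewrite !big_cons big_nil addr0 !addrA.
  by rewrite (perm_big _ eq_s) xy zw !big_cons big_nil /= addr0 !addrA addxx add0r.
have [a0 aV] := mem_rootsG_exp ha; have [b0 bV] := mem_rootsG_exp hb.
have [c0 cV] := mem_rootsG_exp hc; have [d0 dV] := mem_rootsG_exp hd.
have sumV0 : a^-1 + b^-1 + c^-1 + d^-1 = 0.
  (* [2 ^ n] is a power of the characteristic, so raising to it is additive (iterated Frobenius). *)
  have q2 : [pchar F].-nat (2 ^ n)%N by rewrite pnatX pnatE // ch2.
  by rewrite -aV -bV -cV -dV -!exprDn_pchar // sum0 expr0n expn_eq0.
have /eqP := prod_add_eq0 a0 b0 c0 d0 sum0 sumV0.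
(* The vanishing factor names the partner of [a]; removing that pair from [sum0] leaves the other
   two with sum zero. *)
rewrite !mulf_eq0 -orbA => /or3P[] /eqP sum2.
- exists a, b, c, d; split=> //; split; apply: add0P => //.
  by rewrite -sum0 sum2 add0r.
- exists a, c, b, d; split; first by rewrite perm_cons (perm_catCA [:: b] [:: c]).
  by split; apply: add0P => //; rewrite -sum0 (addrAC a) sum2 add0r.
- exists a, d, b, c; split; first by rewrite perm_cons (perm_catC [:: b; c] [:: d]).
  by split; apply: add0P => //; rewrite -sum0 addrAC (addrAC a) sum2 add0r.
Qed.
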